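(* The axiom system $\mathbf{B}$ (any sound and complete axiomatization of classical propositional logic, together with all instances of the axiom schemata (B1), (B2), (B3), (B4), closed under the rules (RE) and (MP)) is a sound and strongly complete axiomatization of the base logic, i.e. of the class of all models: for every $\Gamma\subseteq\mathfrak{L}$ and every $\varphi\in\mathfrak{L}$, $\Gamma\vdash\varphi$ if and only if $\Gamma\Vdash\varphi$, where $\vdash$ is derivability in $\mathbf{B}$ and $\Vdash$ is semantic consequence over the class of all models.
   Context: Fix a (finite or infinite) index set $I$ and a countable set $\mathfrak{P}$ of propositional variables. A group is a non-empty finite subset of $I$; $G,H,J$ always range over groups. Language: $\mathfrak{L}$ is generated from $\mathfrak{P}$ and the constants $\bot,\top$ by the classical connectives ($\bot,\neg,\vee$ primitive, the others and $\top$ defined as usual) and the unary modal operators $\square_G$, one for each group $G$. Write $\square_i$ for $\square_{\{i\}}$. Models: a model is $\mathfrak{M}=\langle W,\langle\mathcal{N}_i\rangle_{i\in I},V\rangle$ with $W\neq\emptyset$, $\mathcal{N}_i:W\to\wp(\wp(W))$ for each $i\in I$, and $V:\mathfrak{P}\to\wp(W)$. For a group $G=\{i_1,\ldots,i_n\}$, $\mathcal{N}_G(w)=\{X_{i_1}\cap\cdots\cap X_{i_n}\mid X_{i_j}\in\mathcal{N}_{i_j}(w)\text{ for each }j\}$. Truth at a world is defined as usual for variables and classical connectives, and $\mathfrak{M},w\models\square_G\varphi$ iff $\|\varphi\|^{\mathfrak{M}}\in\mathcal{N}_G(w)$, where $\|\varphi\|^{\mathfrak{M}}=\{w\in W\mid\mathfrak{M},w\models\varphi\}$.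 For a class of models, $\Gamma\Vdash\varphi$ means: at every world of every model in the class at which all members of $\Gamma$ are true, $\varphi$ is true. Axiom schemata of the base logic: (B1) $(\square_G\varphi\wedge\square_H\psi)\rightarrow\square_{G\cup H}(\varphi\wedge\psi)$, where $G\cap H=\emptyset$; (B2) $\square_{G\cup H}\top\rightarrow\square_G\top$; (B3) $(\square_G\varphi\wedge\square_{G\cup H\cup J}\varphi)\rightarrow\square_{G\cup H}\varphi$; (B4) $(\square_G\varphi\wedge\square_H(\varphi\vee\psi))\rightarrow\square_{G\cup H}\varphi$. Rules: (RE) if $\varphi\vdash\psi$ and $\psi\vdash\varphi$, then $\square_G\varphi\vdash\square_G\psi$; (MP) if $\vdash\varphi$ and $\vdash\varphi\rightarrow\psi$, then $\vdash\psi$. A theorem is a formula derivable from the axioms by the rules; $\Gamma\vdash\varphi$ iff there are $\psi_1,\ldots,\psi_n\in\Gamma$ ($n\ge 0$) such that $(\psi_1\wedge\cdots\wedge\psi_n)\rightarrow\varphi$ is a theorem. *)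

(* Defs.v *)
From mathcomp Require Import all_boot finmap.
From mathcomp Require Import boolp classical_sets.

Set Implicit Arguments.
Unset Strict Implicit.
Unset Printing Implicit Defensive.

Local Open Scope classical_set_scope.

Section Syntax.
Variables (I : choiceType) (P : countType).

Definition group := {G : {fset I} | G != fset0}.

Lemma groupU_subproof (G H : group) : (val G `|` val H)%fset != fset0.
Proof.
case: G => G /= /fset0Pn[i iG]; apply/fset0Pn; exists i.
by rewrite in_fsetU iG.
Qed.

Definition groupU (G H : group) : group :=
  exist (fun K : {fset I} => K != fset0) _ (groupU_subproof G H).

Inductive form : Type :=
| Var of P
| Bot
| Neg of form
| Or of form & form
| Box of group & form.

Definition Top : form := Neg Bot.
Definition And (phi psi : form) : form := Neg (Or (Neg phi) (Neg psi)).
Definition Imp (phi psi : form) : form := Or (Neg phi) psi.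

End Syntax.

Arguments Var {I P}.
Arguments Bot {I P}.
Arguments Neg {I P}.
Arguments Or {I P}.
Arguments Box {I P}.
Arguments Top {I P}.
Arguments And {I P}.
Arguments Imp {I P}.

Section Semantics.
Variables (I : choiceType) (P : countType).

Record model := Model {
  world : Type;
  world_inhabited : inhabited world;
  nbhd : I -> world -> set (set world);
  valuation : P -> set world
}.

(* The values of X outside G are irrelevant. *)
Definition group_nbhd (M : model) (G : group I) (w : world M)
    : set (set (world M)) :=
  [set Y | exists X : I -> set (world M),
    (forall i, i \in val G -> nbhd i w (X i)) /\
    Y = \bigcap_(i in [set` val G]) X i].

Fixpoint sat (M : model) (w : world M) (phi : form I P) : Prop :=
  match phi with
  | Var p => valuation p w
  | Bot => False
  | Neg psi => ~ sat w psi
  | Or psi chi => sat w psi \/ sat w chi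
  | Box G psi => group_nbhd G w [set v | sat v psi]
  end.

Definition consequence (Gamma : set (form I P)) (phi : form I P) : Prop :=
  forall (M : model) (w : world M),
    (forall psi, Gamma psi -> sat w psi) -> sat w phi.

End Semantics.

Section Propositional.
Variables (I : choiceType) (P : countType).
Implicit Types (phi psi : form I P).

(* Only the classical connectives are constrained, so that variables and
   formulas of the form Box G phi both behave as propositional atoms. *)
Definition boolean_valuation (v : form I P -> bool) : Prop :=
  [/\ v Bot = false,
      forall phi, v (Neg phi) = ~~ v phi &
      forall phi psi, v (Or phi psi) = v phi || v psi].

Definition tautology phi : Prop :=
  forall v, boolean_valuation v -> v phi.

Inductive mp_closure (Ax : set (form I P)) : form I P -> Prop :=
| MPC_ax phi : Ax phi -> mp_closure Ax phi
| MPC_mp phi psi :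
    mp_closure Ax phi -> mp_closure Ax (Imp phi psi) -> mp_closure Ax psi.

(* Ax is the set of all instances, in the full modal language, of the axioms
   of a sound and complete system for classical propositional logic. *)
Definition CPL_axiomatization (Ax : set (form I P)) : Prop :=
  forall phi, mp_closure Ax phi <-> tautology phi.

End Propositional.

Section Proofs.
Variables (I : choiceType) (P : countType).
Implicit Types (G H J : group I) (phi psi : form I P).

Inductive base_axiom : form I P -> Prop :=
| B1 G H phi psi : (val G `&` val H = fset0)%fset ->
    base_axiom
      (Imp (And (Box G phi) (Box H psi)) (Box (groupU G H) (And phi psi)))
| B2 G H :
    base_axiom (Imp (Box (groupU G H) Top) (Box G Top))
| B3 G H J phi :
    base_axiom
      (Imp (And (Box G phi) (Box (groupU (groupU G H) J) phi))
           (Box (groupU G H) phi))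
| B4 G H phi psi :
    base_axiom
      (Imp (And (Box G phi) (Box H (Or phi psi))) (Box (groupU G H) phi)).

(* Derivability from Gamma when T is the set of theorems; for n = 0 the
   conjunction is Top. *)
Definition derives_with (T : form I P -> Prop) (Gamma : set (form I P)) phi
    : Prop :=
  exists (n : nat) (psi : 'I_n -> form I P),
    (forall i, Gamma (psi i)) /\
    T (Imp (\big[And/Top]_(i < n) psi i) phi).

(* The conclusion "Box G phi entails Box G psi" of RE is rendered by the
   theorem Box G phi -> Box G psi. *)
Inductive theoremB (Ax : set (form I P)) : form I P -> Prop :=
| ThmCPL phi : Ax phi -> theoremB Ax phi
| ThmBase phi : base_axiom phi -> theoremB Ax phi
| ThmRE G phi psi :
    derives_with (theoremB Ax) [set phi] psi ->
    derives_with (theoremB Ax) [set psi] phi ->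
    theoremB Ax (Imp (Box G phi) (Box G psi))
| ThmMP phi psi :
    theoremB Ax phi -> theoremB Ax (Imp phi psi) -> theoremB Ax psi.

Definition derivable (Ax : set (form I P)) (Gamma : set (form I P)) phi
    : Prop :=
  derives_with (theoremB Ax) Gamma phi.

End Proofs.

(* Main.v *)
Require Import Defs.
From mathcomp Require Import all_boot finmap.
From mathcomp Require Import boolp classical_sets filter.

(** Both directions pass through a purely set-theoretic reading of the axioms.
    Fix a world and call [X] an ability of the group [G] if [X] is the
    intersection of one neighbourhood from each member of [G].  Read with sets
    for formulas, (B1)-(B4) become closure conditions on the relation between
    groups and their abilities ([base_closed]).

    Soundness is the remark that every relation obtained by intersecting
    neighbourhoods satisfies these conditions ([meets_closed]).

    Completeness rests on a converse ([meets_choice_nbhd]): every relation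
    [N] satisfying the conditions on a set [T] is obtained by intersecting
    neighbourhoods, once [T] is replaced by [T * K] for a suitable set [K] of
    copies.  Each pair [a = (G, X)] with [N G X] must be realised by giving
    every member [i] of [G] a neighbourhood, such that these intersect in [X];
    the danger is that neighbourhoods made for different pairs, or for a proper
    part of [G], intersect in something that [N] does not license.  So a copy
    [k] of a point chooses, for every pair [a], one member [k a] of its group,
    and the neighbourhood given to [i] for the sake of [a] is the set of the
    [(x, k)] with [X x] or [k a <> i].  Since [k a] is in [G], all members
    of [G] together get exactly [X]; since the choices for distinct pairs are
    independent, and [k a] can avoid any proper part of [G], the members of a
    group [H] using neighbourhoods made for various pairs get a set of the form
    [X * K] only if [X] is the intersection of the second components of those
    pairs whose group takes part as a whole, all other second components
    including [X].  (B1) then makes [X] an ability of the union [D] of the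
    groups taking part as a whole, (B4) an ability of the union of all the
    groups involved, and [H] lies between the two, so that (B3) makes [X] an
    ability of [H]; (B2) and (B4) settle the case where [D] is empty and [X] is
    everything.

    The points of the canonical model are the boolean valuations of formulas
    that verify all theorems, in other words the maximal consistent sets.  That
    there are enough of them is obtained from an ultrafilter on the set of all
    boolean valuations, as the language may be uncountable. *)

Set Implicit Arguments.
Unset Strict Implicit.
Unset Printing Implicit Defensive.

Local Open Scope classical_set_scope.

(** * Abilities of groups *)

Section Abilities.
Variable I : choiceType.
Implicit Types G H K : group I.

Lemma in_groupU G H i :
  (i \in val (groupU G H)) = (i \in val G) || (i \in val H).
Proof. by rewrite in_fsetU. Qed.

Lemma groupU_absorb G H : {subset val G <= val H} -> groupU G H = H.
Proof.
move=> GH; apply/val_inj/fsetP => i; rewrite in_groupU.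
by case: (boolP (i \in val G)) => // /GH ->.
Qed.

Lemma group_member G : exists i, i \in val G.
Proof. by case: G => G /= /fset0Pn. Qed.

(** (B1)-(B4) with sets for formulas.  Inclusions between groups replace the
    unions in (B2) and (B3), and an inclusion between sets the disjunction in
    (B4). *)
Record base_closed T (N : group I -> set (set T)) : Prop := BaseClosed {
  closed_disjoint : forall G H X Y, (val G `&` val H = fset0)%fset ->
    N G X -> N H Y -> N (groupU G H) (X `&` Y);
  closed_setT : forall G K, {subset val G <= val K} ->
    N K setT -> N G setT;
  closed_between : forall G H K X, {subset val G <= val H} ->
    {subset val H <= val K} -> N G X -> N K X -> N H X;
  closed_join : forall G H X Y, X `<=` Y ->
    N G X -> N H Y -> N (groupU G H) X }.

Definition meets T (N : I -> set (set T)) G : set (set T) :=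
  [set Y | exists X : I -> set T,
    (forall i, i \in val G -> N i (X i)) /\
    Y = \bigcap_(i in [set` val G]) X i].

(** In (B1), (B3) and (B4) alike, a member of the first group keeps its
    neighbourhood and the remaining individuals use the one provided by the
    second premise. *)
Lemma meets_closed T (N : I -> set (set T)) : base_closed (meets N).
Proof.
pose glue G (X Y : I -> set T) i := if i \in val G then X i else Y i.
have glueN G H K X Y : (forall i, i \in val G -> N i (X i)) ->
    (forall i, i \in val K -> N i (Y i)) ->
    {subset val H <= val (groupU G K)} ->
    forall i, i \in val H -> N i (glue G X Y i).
  move=> NX NY HGK i /HGK; rewrite in_groupU /glue.
  by case: ifP => [iG _|_ /= iK]; [exact: NX|exact: NY].
split.
- move=> G H _ _ GH0 [X [NX ->]] [Y [NY ->]].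
  exists (glue G X Y); split; first exact: (glueN _ _ H).
  apply/seteqP; split=> [x [Xx Yx] i /=|x XYx].
    rewrite in_groupU /glue; case: ifP => [iG _|_ /= iH]; first exact: Xx.
    exact: Yx.
  split=> i /= iGH; move: (XYx i); rewrite /= in_groupU iGH ?orbT /glue.
    by rewrite iGH; exact.
  have /negbTE-> : i \notin val G.
    apply/negP => iG; have: i \in (val G `&` val H)%fset.
      by rewrite in_fsetI iG.
    by rewrite GH0 in_fset0.
  exact.
- move=> G K GK [X [NX XT]]; exists X; split=> [i /GK/NX //|].
  apply/esym/seteqP; split=> // x _ i /= /GK iK.
  by have: [set: T] x by []; rewrite XT => /(_ i iK).
- move=> G H K Z GH HK [X [NX ZX]] [Y [NY ZY]].
  exists (glue G X Y); split.
    by apply: (glueN _ _ K) => // i /HK; rewrite in_groupU => ->; rewrite orbT.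
  apply/seteqP; split=> [x Zx i /= iH|x XYx].
    rewrite /glue; case: ifP => [iG|_].
      by move: Zx; rewrite ZX => /(_ i iG).
    by move: Zx; rewrite ZY => /(_ i (HK i iH)).
  rewrite ZX => i /= iG.
  by have := XYx i (GH i iG); rewrite /glue iG.
- move=> G H X' Y' XY [X [NX XE]] [Y [NY YE]].
  exists (glue G X Y); split; first exact: (glueN _ _ H).
  apply/seteqP; split=> [x Xx i /=|x XYx].
    rewrite in_groupU /glue; case: ifP => [iG _|_ /= iH].
      by move: Xx; rewrite XE => /(_ i iG).
    by move: (XY _ Xx); rewrite YE => /(_ i iH).
  rewrite XE => i /= iG.
  by have := XYx i; rewrite /= in_groupU iG /glue iG; exact.
Qed.

(** * Realising a closed relation by intersections of neighbourhoods *)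

Section Realisation.
Variable T : Type.
Implicit Types a : group I * set T.

(** Combining abilities: each member [j] of [H] draws its neighbourhood from a
    pair [a j], whose group contains [j]. *)
Section Combination.
Variables (N : group I -> set (set T)) (cN : base_closed N).
Variables (H : group I) (a : I -> group I * set T).
Hypothesis aN : forall j, j \in val H -> N (a j).1 (a j).2.
Hypothesis a_mem : forall j, j \in val H -> j \in val (a j).1.

(** Every individual of the group of [a j] is in [H] and draws from the same
    pair as [j], so that their neighbourhoods intersect in [(a j).2] alone. *)
Definition full (j : I) : Prop :=
  forall i, i \in val (a j).1 -> i \in val H /\ a i = a j.

(** The groups of two pairs taking part as a whole are equal or disjoint, as
    each individual uses one pair; so (B1) applies. *)
Lemma full_meet (r : seq I) :
    r != [::] -> (forall j, j \in r -> j \in val H /\ full j) ->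
  exists D : group I,
    (forall i, i \in val D <-> exists2 j, j \in r & i \in val (a j).1) /\
    N D [set x | forall j, j \in r -> (a j).2 x].
Proof.
elim: r => // j r IH _ rfull.
have [jH jfull] := rfull j (mem_head _ _).
have {}rfull i : i \in r -> i \in val H /\ full i.
  by move=> ir; apply: rfull; rewrite inE ir orbT.
have [r0|rn0] := eqVneq r [::].
  exists (a j).1; split=> [i|]; first split=> [ij|[j' /[!r0] /[!inE] /eqP-> //]].
    by exists j; rewrite // mem_head.
  rewrite r0; suff -> : [set x | forall i, i \in [:: j] -> (a i).2 x] = (a j).2.
    exact: aN.
  apply/seteqP; split=> [x /(_ j)|x jx i]; first by apply; rewrite mem_head.
  by rewrite inE => /eqP->.
have [D [DE ND]] := IH rn0 rfull.
have [[i [ir aij]]|fresh_j] := pselect (exists i, i \in r /\ a i = a j).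
  exists D; split=> [x|].
    rewrite DE; split=> -[k kr xk]; first by exists k; rewrite // inE kr orbT.
    move: kr xk; rewrite inE => /orP[/eqP->|kr] xk; last by exists k.
    by exists i; rewrite // aij.
  suff -> : [set x | forall k, k \in j :: r -> (a k).2 x] =
            [set x | forall k, k \in r -> (a k).2 x] by [].
  apply/seteqP; split=> x rx k; first by move=> kr; apply: rx; rewrite inE kr orbT.
  by rewrite inE => /orP[/eqP->|]; [rewrite -aij; exact: rx|exact: rx].
exists (groupU (a j).1 D); split=> [x|].
  rewrite in_groupU; split=> [/orP[xj|/DE[k kr xk]]|[k]].
  - by exists j; rewrite // mem_head.
  - by exists k; rewrite // inE kr orbT.
  rewrite inE => /orP[/eqP-> -> //|kr xk].
  by apply/orP; right; apply/DE; exists k.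
suff -> : [set x | forall k, k \in j :: r -> (a k).2 x] =
    (a j).2 `&` [set x | forall k, k \in r -> (a k).2 x].
  apply: (closed_disjoint cN) => //; last exact: aN.
  apply/fsetP => x; rewrite in_fsetI in_fset0; apply/negP => /andP[xj /DE[k kr xk]].
  apply: fresh_j; exists k; split=> //.
  by have [_ <-] := jfull _ xj; have [_ /(_ _ xk)[_ ->]] := rfull _ kr.
apply/seteqP; split=> [x rx|x [jx rx] k].
  by split=> [|k kr]; apply: rx; rewrite inE ?eqxx ?kr ?orbT.
by rewrite inE => /orP[/eqP->|/rx].
Qed.

Lemma join_pairs (D : group I) (X : set T) (r : seq I) :
    N D X -> {subset r <= val H} ->
    (forall j, j \in r -> X `<=` (a j).2) ->
  exists D' : group I,
    [/\ {subset val D <= val D'},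
        (forall j, j \in r -> {subset val (a j).1 <= val D'}) & N D' X].
Proof.
move=> ND; elim: r => [|j r IH] rH Xr; first by exists D; split.
have [||D' [DD' rD' ND']] := IH.
- by move=> i ir; apply: rH; rewrite inE ir orbT.
- by move=> i ir; apply: Xr; rewrite inE ir orbT.
exists (groupU D' (a j).1); split.
- by move=> i /DD'; rewrite in_groupU => ->.
- move=> k; rewrite inE => /orP[/eqP->|kr] i ik; rewrite in_groupU.
    by rewrite ik orbT.
  by rewrite (rD' k).
- by apply: (closed_join cN) ND' (aN _); [apply: Xr|apply: rH]; rewrite mem_head.
Qed.

(** [H] lies between the union of the groups taking part as a whole and the
    union of all the groups involved; [X] is an ability of the former by (B1)
    and of the latter by (B4), hence of [H] by (B3).  If no group takes part as
    a whole, [X] is everything and (B2) replaces (B3). *)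
Lemma combination_closed (X : set T) :
    (forall j, j \in val H -> X `<=` (a j).2) ->
    (forall x, (forall j, j \in val H -> full j -> (a j).2 x) -> X x) ->
  N H X.
Proof.
move=> Xa aX.
have HD' (D' : group I) : (forall j, j \in val H -> {subset val (a j).1 <= val D'}) ->
    {subset val H <= val D'}.
  by move=> aD' j jH; apply: aD' (a_mem jH).
pose r := [seq j <- val H | `[< full j >]].
have rP j : j \in r <-> j \in val H /\ full j.
  by rewrite mem_filter; split=> [/andP[/asboolP]|[-> /asboolP->]].
have XE : X = [set x | forall j, j \in r -> (a j).2 x].
  apply/seteqP; split=> [x Xx j /rP[jH _]|x rx]; first exact: Xa.
  by apply: aX => j jH jfull; apply: rx; apply/rP.
have [r0|rn0] := eqVneq r [::].
  have XT : X = setT by rewrite XE r0; apply/seteqP.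
  have [j jH] := group_member H.
  have jT : (a j).2 = setT by apply/seteqP; split=> // x _; apply: Xa => //; rewrite XT.
  have NjX : N (a j).1 X by rewrite XT -jT; exact: aN.
  have [//|D' [_ aD' ND']] := join_pairs (r := val H) NjX _ Xa.
  by move: ND'; rewrite XT; apply: closed_setT cN _ _ (HD' _ aD').
have [j /rP//|D [DE]] := full_meet rn0.
rewrite -XE => ND.
have [//|D' [_ aD' ND']] := join_pairs (r := val H) ND _ Xa.
apply: (closed_between cN _ (HD' _ aD') ND ND').
by move=> i /DE[j /rP[_ jfull] /jfull[]].
Qed.

End Combination.

Definition copies := {k : group I * set T -> I | forall a, k a \in val a.1}.

Lemma copies_inhabited : inhabited copies.
Proof.
have [k kP] := choice (fun a : group I * set T => group_member a.1).
by split; exists k.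
Qed.

(** This is what forces an intersection of the form [X * copies] to lie in the
    second component of every pair involved: at the copies choosing [i], the
    neighbourhood made for [i] reduces to [a.2]. *)
Lemma copy_choosing a i : i \in val a.1 -> exists k : copies, sval k a = i.
Proof.
move=> ia; case: copies_inhabited => -[k kP].
pose k' b := if pselect (b = a) is left _ then i else k b.
have k'P b : k' b \in val b.1 by rewrite /k'; case: pselect => [->|].
by exists (exist _ k' k'P) => /=; rewrite /k'; case: pselect.
Qed.

(** One copy avoids at once, for each pair, those members of its group that
    satisfy [S], unless they all do: at this copy only the pairs whose group
    takes part as a whole constrain the point. *)
Lemma copy_avoiding (S : group I * set T -> I -> Prop) :
  exists k : copies, forall a, S a (sval k a) ->
    forall i, i \in val a.1 -> S a i.
Proof.
have /choice[k kP] : forall a, exists i, i \in val a.1 /\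
    (S a i -> forall j, j \in val a.1 -> S a j).
  move=> a; have [allS|] := pselect (forall j, j \in val a.1 -> S a j).
    by have [i ia] := group_member a.1; exists i.
  move=> /existsNP[i /not_implyP[ia nS]]; exists i; split=> // /nS [].
by exists (exist _ k (fun a => (kP a).1)) => a Sa; apply: (kP a).2.
Qed.

Definition choice_set a (i : I) : set (T * copies) :=
  [set xk | a.2 xk.1 \/ sval xk.2 a <> i].

Definition choice_nbhd (N : group I -> set (set T)) (i : I) :
    set (set (T * copies)) :=
  [set Y | exists a, [/\ N a.1 a.2, i \in val a.1 & Y = choice_set a i]].

(** From right to left, [H] uses the neighbourhoods made for the pair [(H, X)]
    itself; from left to right, the two lemmas on copies turn an arbitrary choice
    of neighbourhoods into the hypotheses of [combination_closed]. *)
Lemma meets_choice_nbhd (N : group I -> set (set T)) (H : group I) (X : set T) :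
  base_closed N -> meets (choice_nbhd N) H [set xk | X xk.1] <-> N H X.
Proof.
move=> cN; split=> [[Y [NY XY]]|NX]; last first.
  exists (choice_set (H, X)); split; first by move=> i iH; exists (H, X).
  apply/seteqP; split=> [[x k] /= Xx i iH|[x k] Xx]; first by left.
  have [//|/=] := Xx (sval k (H, X)) (svalP k (H, X)).
  by case.
have /choice[a aP] : forall i, exists a, i \in val H ->
    [/\ N a.1 a.2, i \in val a.1 & Y i = choice_set a i].
  move=> i; have [/NY[a aP]|niH] := boolP (i \in val H); first by exists a.
  by exists (H, X).
have XP x k : X x <-> forall j, j \in val H -> choice_set (a j) j (x, k).
  have -> : X x = [set xk | X xk.1] (x, k) by [].
  rewrite XY; split=> Yx j jH; have [_ _ YE] := aP j jH.
    by rewrite -YE; exact: Yx.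
  by rewrite YE; exact: Yx.
apply: (combination_closed cN (a := a)).
- by move=> j /aP[].
- by move=> j /aP[].
- move=> j jH x Xx; have [_ ja _] := aP j jH.
  have [k kj] := copy_choosing ja.
  by have [//|/=] := (XP x k).1 Xx j jH.
- move=> x fullx.
  have [k kP] := copy_avoiding (fun b i => i \in val H /\ a i = b).
  apply/(XP x k) => j jH.
  have [kj|] := pselect (sval k (a j) = j); last by right.
  by left; apply: fullx => // i; apply: kP; rewrite kj.
Qed.

End Realisation.
End Abilities.

(** * Propositional reasoning *)

Section Derivations.
Variables (I : choiceType) (P : countType).
Implicit Types (phi psi chi : form I P).
Implicit Types (Gamma Delta : set (form I P)).

Section Connectives.
Variables (v : form I P -> bool) (bv : boolean_valuation v).

Lemma val_Top : v Top.
Proof. by case: bv => vB vN _; rewrite /Top vN vB. Qed.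

Lemma val_And phi psi : v (And phi psi) = v phi && v psi.
Proof. by case: bv => _ vN vO; rewrite /And vN vO !vN negb_or !negbK. Qed.

Lemma val_Imp phi psi : v (Imp phi psi) = (v phi ==> v psi).
Proof. by case: bv => _ vN vO; rewrite /Imp vO vN implybE. Qed.

Lemma val_bigAnd n (psi : 'I_n -> form I P) :
  v (\big[And/Top]_(i < n) psi i) = [forall i, v (psi i)].
Proof. by rewrite (big_morph v val_And val_Top) big_andE. Qed.

End Connectives.

Lemma sat_valuation (M : model I P) (w : world M) :
  boolean_valuation (fun phi => `[< sat w phi >]).
Proof.
split=> [|phi|phi psi] /=; first exact: asboolF.
  by rewrite asbool_neg.
by rewrite asbool_or.
Qed.

Variables (Ax : set (form I P)) (hAx : CPL_axiomatization Ax).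
Local Notation thm := (theoremB Ax).

Lemma thm_tautology phi : tautology phi -> thm phi.
Proof.
move=> /hAx; elim=> [psi|psi chi _ + _]; first exact: ThmCPL.
exact: ThmMP.
Qed.

Lemma thm_consequence2 phi psi chi : thm phi -> thm psi ->
    (forall v, boolean_valuation v -> v phi -> v psi -> v chi) ->
  thm chi.
Proof.
move=> Tphi Tpsi ent; apply: ThmMP Tpsi (ThmMP Tphi (thm_tautology _)).
move=> v bv; rewrite !val_Imp //.
by apply/implyP => vphi; apply/implyP; exact: ent.
Qed.

Lemma derivable_thm Gamma phi : thm phi -> derivable Ax Gamma phi.
Proof.
move=> Tphi; exists 0, (fun=> phi); split=> [[] //|].
apply: (thm_consequence2 Tphi Tphi) => v bv vphi _.
by rewrite val_Imp // vphi implybT.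
Qed.

Lemma derivable_mem Gamma phi : Gamma phi -> derivable Ax Gamma phi.
Proof.
move=> Gphi; exists 1%N, (fun=> phi); split=> //.
apply: thm_tautology => v bv; rewrite val_Imp // val_bigAnd //.
by apply/implyP => /forallP/(_ ord0).
Qed.

Lemma derivable_consequence2 Gamma phi psi chi :
    derivable Ax Gamma phi -> derivable Ax Gamma psi ->
    (forall v, boolean_valuation v -> v phi -> v psi -> v chi) ->
  derivable Ax Gamma chi.
Proof.
move=> [m [f [fG Tf]]] [n [g [gG Tg]]] ent.
exists (m + n)%N, (fun i => match split i with inl j => f j | inr j => g j end).
split=> [i|]; first by case: (split i).
apply: (thm_consequence2 Tf Tg) => v bv.
rewrite !val_Imp // !val_bigAnd // => /implyP vf /implyP vg.
apply/implyP => /forallP vfg; apply: ent => //.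
  by apply/vf/forallP => j; have := vfg (lshift n j); rewrite (unsplitK (inl j)).
by apply/vg/forallP => j; have := vfg (rshift m j); rewrite (unsplitK (inr j)).
Qed.

(** * The canonical model *)

Definition canonical_world := {v : form I P -> bool |
  boolean_valuation v /\ forall phi, thm phi -> v phi}.

Definition truth_set phi : set canonical_world :=
  [set v : canonical_world | sval v phi].

(** If [phi] is not derivable, the boolean valuations refuting [phi] and
    verifying a formula derivable from [Gamma] form, as this formula varies, the
    base of a proper filter.  Truth almost everywhere for an ultrafilter above
    it is the valuation sought. *)
Lemma canonical_complete Gamma phi :
    (forall v : canonical_world,
      (forall psi, Gamma psi -> sval v psi) -> sval v phi) ->
  derivable Ax Gamma phi.
Proof.
move=> valid; apply: contrapT => nder.
pose valuations := {v : form I P -> bool | boolean_valuation v}.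
pose F : set (set valuations) := [set S | exists2 chi,
  derivable Ax Gamma chi &
  forall v : valuations, sval v chi -> ~~ sval v phi -> S v].
have FP : ProperFilter F.
  split=> [[chi dchi chi0]|].
    apply/nder/(derivable_consequence2 dchi dchi) => v bv vchi _.
    by apply/negPn/negP => /(chi0 (exist _ v bv) vchi).
  split=> [|A B [chi dchi chiA] [psi dpsi psiB]|A B AB [chi dchi chiA]].
  - exists Top => //; apply/derivable_thm/thm_tautology => v; exact: val_Top.
  - exists (And chi psi).
      apply: (derivable_consequence2 dchi dpsi) => v bv vchi vpsi.
      by rewrite val_And // vchi.
    move=> v; rewrite val_And; last exact: (svalP v).
    by move=> /andP[? ?] ?; split; [exact: chiA|exact: psiB].
  - by exists chi => // v vchi nvphi; apply/AB/chiA.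
have [U [UU FU]] := ultraFilterLemma FP.
have UP : ProperFilter U := ultra_proper.
have UF : Filter U := filter_filter.
pose u psi := `[< U [set v : valuations | sval v psi] >].
have UN psi : U [set v : valuations | ~~ sval v psi] <-> ~ U [set v : valuations | sval v psi].
  split=> [Un Up|nUp].
    apply: (filter_not_empty U); apply: filterS (filterI Un Up) => v /= [].
    by move=> /negP.
  have [//|] := in_ultra_setVsetC [set v : valuations | sval v psi] UU.
  by apply: filterS => v /negP.
have bu : boolean_valuation u.
  split=> [|psi|psi chi]; rewrite /u.
  - apply: asboolF => UBot; apply: (filter_not_empty U).
    by apply: filterS UBot => -[v [vBot ? ?]] /=; rewrite vBot.
  - rewrite -asbool_neg; apply: asbool_equiv_eq; rewrite -UN.
    by split; apply: filterS => -[v [? vN ?]] /=; rewrite vN.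
  - rewrite -asbool_or; apply: asbool_equiv_eq; split=> [Uor|].
      apply: contrapT => /not_orP[/UN Un1 /UN Un2].
      apply: (filter_not_empty U).
      apply: filterS (filterI Uor (filterI Un1 Un2)) => -[v [? ? vO]] /=.
      by rewrite vO => -[/orP[->|->] []].
    by case; apply: filterS => -[v [? ? vO]] /=; rewrite vO => ->; rewrite ?orbT.
have uder psi : derivable Ax Gamma psi -> u psi.
  by move=> dpsi; apply/asboolP/FU; exists psi.
have uthm psi : thm psi -> u psi by move=> /(derivable_thm Gamma)/uder.
have : u phi.
  apply: (valid (exist _ u (conj bu uthm))) => psi Gpsi.
  exact/uder/derivable_mem.
move=> /asboolP; apply/UN; apply: FU; exists Top.
  by apply/derivable_thm/thm_tautology => v; exact: val_Top.
by [].
Qed.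

Lemma truth_set_Box G phi psi :
  truth_set phi = truth_set psi -> truth_set (Box G phi) = truth_set (Box G psi).
Proof.
have half chi chi' : truth_set chi = truth_set chi' ->
    truth_set (Box G chi) `<=` truth_set (Box G chi').
  move=> E v /= vchi.
  have /(svalP v).2 : thm (Imp (Box G chi) (Box G chi')).
    apply: ThmRE; apply: canonical_complete => u /(_ _ erefl) uchi.
      by have : truth_set chi u by []; rewrite E.
    by have : truth_set chi' u by []; rewrite -E.
  by rewrite (val_Imp (svalP v).1) /= vchi.
by move=> E; apply/seteqP; split; apply: half.
Qed.

Definition canonical_ability (v : canonical_world) (G : group I) :
    set (set canonical_world) :=
  [set X | exists2 phi, X = truth_set phi & sval v (Box G phi)].

(** By (RE), the formula chosen to name a definable set does not matter. *)
Lemma canonical_abilityP (v : canonical_world) G phi :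
  canonical_ability v G (truth_set phi) <-> sval v (Box G phi).
Proof.
split=> [[psi /(truth_set_Box G) E vpsi]|]; last by exists phi.
by have : truth_set (Box G psi) v by []; rewrite -E.
Qed.

Lemma canonical_ability_closed v : base_closed (canonical_ability v).
Proof.
have [bv vthm] := svalP v.
have ax phi psi : base_axiom (Imp phi psi) -> sval v phi -> sval v psi.
  by move=> /(ThmBase Ax)/vthm; rewrite val_Imp // => /implyP.
have truth_Top : truth_set Top = setT.
  by apply/seteqP; split=> // u _; exact: (val_Top (svalP u).1).
split.
- move=> G H _ _ GH0 [phi -> vphi] [psi -> vpsi]; exists (And phi psi).
    apply/seteqP; split=> u; rewrite /truth_set /= (val_And (svalP u).1).
      by case=> -> ->.
    by move=> /andP[].
  by apply: ax (B1 _ _ GH0) _; rewrite val_And // vphi.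
- move=> G K GK; rewrite -truth_Top => /canonical_abilityP vK.
  apply/canonical_abilityP; apply: ax (B2 _ G K) _.
  by rewrite groupU_absorb.
- move=> G H K _ GH HK [phi -> vphi] /canonical_abilityP vK.
  apply/canonical_abilityP; rewrite -(groupU_absorb GH).
  apply: ax (B3 G H K phi) _; rewrite val_And // vphi /=.
  by rewrite (groupU_absorb GH) (groupU_absorb HK).
- move=> G H X Y XY [phi XE vphi] [psi YE vpsi].
  have sub (u : canonical_world) : sval u phi -> sval u psi by move: XY; rewrite XE YE => /(_ u).
  rewrite XE {XE YE XY}.
  apply/canonical_abilityP; apply: ax (B4 G H phi psi) _.
  rewrite val_And // vphi /=; apply/canonical_abilityP.
  exists psi => //; apply/seteqP; split=> u; have [[_ _ uO] _] := svalP u.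
    by rewrite /truth_set /= uO => /orP[/sub|].
  by rewrite /truth_set /= uO => ->; rewrite orbT.
Qed.

Definition canonical_model (v0 : canonical_world) : model I P :=
  @Model I P (canonical_world * copies I canonical_world)
    (let: inhabits k := copies_inhabited I canonical_world in inhabits (v0, k))
    (fun i w => choice_nbhd (canonical_ability w.1) i)
    (fun p w => sval w.1 (Var p)).

Lemma canonical_truth v0 phi (w : world (canonical_model v0)) :
  sat w phi <-> sval w.1 phi.
Proof.
elim: phi w => [p|  |phi IH|phi IH psi IH'|G phi IH] [v k] //=;
  have [[vBot vN vO] _] := svalP v.
- by rewrite vBot.
- by rewrite vN IH; split=> /negP.
- by rewrite vO IH IH'; split=> /orP.
- have -> : [set w : world (canonical_model v0) | sat w phi] =
            [set w | truth_set phi w.1].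
    by apply/seteqP; split=> w /IH.
  rewrite -canonical_abilityP.
  exact/meets_choice_nbhd/canonical_ability_closed.
Qed.

(** * Soundness *)

Lemma sat_Imp (M : model I P) (w : world M) phi psi :
  sat w (Imp phi psi) <-> (sat w phi -> sat w psi).
Proof.
have bw := sat_valuation w.
split=> [/asboolP|imp].
  by rewrite (val_Imp bw) => /implyP imp /asboolP/imp/asboolP.
by apply/asboolP; rewrite (val_Imp bw); apply/implyP => /asboolP/imp/asboolP.
Qed.

Lemma sat_And (M : model I P) (w : world M) phi psi :
  sat w (And phi psi) <-> sat w phi /\ sat w psi.
Proof. by rewrite /= -not_andE notK. Qed.

Lemma base_axiom_sound phi (M : model I P) (w : world M) :
  base_axiom phi -> sat w phi.
Proof.
have cN : base_closed (fun G => group_nbhd G w) :=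
  meets_closed (fun i => nbhd i w).
case=> [G H psi chi GH0|G H|G H J psi|G H psi chi]; apply/sat_Imp.
- move=> /sat_And[/= Gpsi Hchi].
  have := closed_disjoint cN GH0 Gpsi Hchi.
  by congr (group_nbhd _ _ _); apply/seteqP; split=> u /sat_And.
- move=> /=; have -> : [set u : world M | ~ False] = setT.
    by apply/seteqP; split=> // u _ [].
  by apply: (closed_setT cN) => i; rewrite in_groupU => ->.
- move=> /sat_And[]; apply: (closed_between cN) => i;
    by rewrite !in_groupU => ->.
- by move=> /sat_And[]; apply: (closed_join cN) => u; left.
Qed.

Definition valid phi : Prop := forall (M : model I P) (w : world M), sat w phi.

Lemma derives_with_sound Gamma phi :
  derives_with valid Gamma phi -> consequence Gamma phi.
Proof.
move=> [n [f [fG valid_f]]] M w Gw.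
have /sat_Imp := valid_f M w; apply.
apply/asboolP; rewrite (val_bigAnd (sat_valuation w)).
by apply/forallP => i; apply/asboolP/Gw.
Qed.

Lemma theorem_sound phi : thm phi -> valid phi.
Proof.
(* The premises of (RE) sit inside derives_with, so the induction is written
   out by hand. *)
move: phi; fix IH 2 => phi; case=> {phi} [phi Aphi|phi Bphi|G phi psi|phi psi].
- move=> M w; apply/asboolP.
  exact: ((hAx phi).1 (MPC_ax Aphi) _ (sat_valuation w)).
- by move=> M w; exact: base_axiom_sound.
- move=> [m [f [fphi /IH Tf]]] [n [g [gpsi /IH Tg]]] M w; apply/sat_Imp.
  have phi_psi : consequence [set phi] psi.
    by apply: derives_with_sound; exists m, f.
  have psi_phi : consequence [set psi] phi.
    by apply: derives_with_sound; exists n, g.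
  congr (group_nbhd _ _ _); apply/seteqP; split=> u uX.
    by apply: phi_psi => _ ->.
  by apply: psi_phi => _ ->.
- by move=> /IH Tphi /IH Timp M w; have /sat_Imp := Timp M w; apply; exact: Tphi.
Qed.

End Derivations.

Theorem theorem1 (I : choiceType) (P : countType) (Ax : set (form I P))
    (hAx : CPL_axiomatization Ax) (Gamma : set (form I P)) (phi : form I P) :
  derivable Ax Gamma phi <-> consequence Gamma phi.
Proof.
split=> [[n [f [fG /(theorem_sound hAx) valid_f]]]|cons].
  by apply: derives_with_sound; exists n, f.
apply: (canonical_complete hAx) => v vG.
have [k] := copies_inhabited I (canonical_world Ax).
apply/(canonical_truth hAx (v0 := v) phi (v, k))/cons => psi /vG.
by move/(canonical_truth hAx (v0 := v) psi (v, k)).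
Qed.
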